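(* For every nowhere dense class of graphs $\mathcal{C}$, there exists a function $g:\mathbb{N}\to\mathbb{N}$ such that for every $h\geq 1$, every poset $P$ of height at most $h$ whose cover graph $G$ is in $\mathcal{C}$ satisfies $$\dim(P)\leq (3c)^{g(h)},$$ where $c:=\operatorname{wcol}_{4h-4}(G)$.
   Context: Graphs and posets are finite and nonempty. A class of graphs is nowhere dense if for every integer $r\geq 1$ there exists $t\geq 1$ such that no graph in the class contains, as a subgraph, a subdivision of the complete graph $K_t$ in which each edge is subdivided at most $r$ times. The height of a poset is the maximum size of a chain in it. An element $y$ covers an element $x$ in $P$ if $x<y$ in $P$ and there is no $z$ with $x<z<y$ in $P$. The cover graph of $P$ is the undirected graph on the elements of $P$ whose edges are the pairs $\{x,y\}$ such that one of $x,y$ covers the other. The dimension $\dim(P)$ is the least $d$ such that the set $\operatorname{Inc}(P)$ of ordered pairs $(x,y)$ of incomparable elements of $P$ can be partitioned into $d$ reversible sets, where $I\subseteq \operatorname{Inc}(P)$ is reversible if some linear extension $L$ of $P$ satisfies $x>y$ in $L$ for all $(x,y)\in I$; if $\operatorname{Inc}(P)=\emptyset$ then $\dim(P)=1$. Weak coloring numbers: let $G$ be a graph, $\pi$ a linear order on $V(G)$, and $r\geq 0$ an integer. A vertex $u$ is weakly $r$-reachable from $v$ w.r.t. $\pi$ if there is a path of length at most $r$ (number of edges) from $v$ to $u$ in $G$ whose smallest vertex w.r.t. $\pi$ is $u$. Let $\operatorname{WReach}_r^{\pi}[v]$ be the set of vertices weakly $r$-reachable from $v$ (it contains $v$). The weak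 $r$-coloring number is $\operatorname{wcol}_r(G):=\min_{\pi}\max_{v\in V(G)}|\operatorname{WReach}_r^{\pi}[v]|$, the minimum being over all linear orders $\pi$ on $V(G)$. *)

(* Defs.v *)
From mathcomp Require Import all_boot all_order.

Set Implicit Arguments.
Unset Strict Implicit.
Unset Printing Implicit Defensive.

Import Order.TTheory.

Record sgraph := SGraph {
  vertex :> finType;
  adj : rel vertex;
  adj_sym : symmetric adj;
  adj_irrefl : irreflexive adj;
  vertex_gt0 : 0 < #|vertex|
}.

(* A linear order is encoded by its graph: (x, y) \in L means x <= y in L.
   Reflexivity follows from totality. *)
Definition linear_order (T : finType) (L : {set T * T}) : bool :=
  [&& [forall x, forall y, ((x, y) \in L) || ((y, x) \in L)],
      [forall x, forall y, ((x, y) \in L) && ((y, x) \in L) ==> (x == y)]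
    & [forall x, forall y, forall z,
         ((x, y) \in L) && ((y, z) \in L) ==> ((x, z) \in L)]].

(* G contains, as a subgraph, a subdivision of K_t in which each edge is
   subdivided at most r times: b gives the t branch vertices and, for i < j,
   p i j lists the subdivision vertices of the edge {i, j}, in order from b i
   to b j.  The values of p i j for j <= i are not used. *)
Definition has_subdivided_clique (r t : nat) (G : sgraph) : Prop :=
  exists (b : 'I_t -> G) (p : 'I_t -> 'I_t -> seq G),
    [/\ injective b,
        forall i j : 'I_t, i < j ->
          [/\ path (@adj G) (b i) (rcons (p i j) (b j)),
              uniq (p i j) & size (p i j) <= r],
        forall i j k : 'I_t, i < j -> b k \notin p i j
      & forall i j k l : 'I_t, i < j -> k < l -> (i, j) != (k, l) ->
          [disjoint p i j & p k l]].

Definition nowhere_dense (C : sgraph -> Prop) : Prop :=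
  forall r : nat, 1 <= r ->
    exists2 t : nat, 1 <= t & forall G, C G -> ~ has_subdivided_clique r t G.

Section WeakColoring.
Variable G : sgraph.

Definition weakly_reachable (pi : {set G * G}) (r : nat) (v u : G) : bool :=
  [exists k : 'I_r.+1, exists p : k.-tuple G,
    [&& path (@adj G) v p, uniq (v :: p), last v p == u
      & all (fun w => (u, w) \in pi) (v :: p)]].

Definition WReach (pi : {set G * G}) (r : nat) (v : G) : {set G} :=
  [set u | weakly_reachable pi r v u].

(* Every WReach pi r v has at most #|G| elements and a linear order exists, so
   the starting value #|G| does not affect the minimum. *)
Definition wcol (r : nat) : nat :=
  \big[minn/#|G|]_(pi : {set G * G} | linear_order pi)
    \max_(v : G) #|WReach pi r v|.

End WeakColoring.

Section Posets.
Variables (d : Order.disp_t) (P : finPOrderType d).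

Definition chain (A : {set P}) : bool :=
  [forall x in A, forall y in A, (x >=< y)%O].

Definition height : nat := \max_(A : {set P} | chain A) #|A|.

Definition covers (y x : P) : bool :=
  (x < y)%O && ~~ [exists z, (x < z)%O && (z < y)%O].

Definition cover_adj (x y : P) : bool := covers x y || covers y x.

Lemma cover_adj_sym : symmetric cover_adj.
Proof. by move=> x y; rewrite /cover_adj orbC. Qed.

Lemma cover_adj_irrefl : irreflexive cover_adj.
Proof. by move=> x; rewrite /cover_adj /covers ltxx. Qed.

Definition cover_graph (P_gt0 : 0 < #|P|) : sgraph :=
  SGraph cover_adj_sym cover_adj_irrefl P_gt0.

Definition Inc : {set P * P} := [set xy | (xy.1 >< xy.2)%O].

Definition linear_extension (L : {set P * P}) : bool :=
  linear_order L && [forall x, forall y, (x <= y)%O ==> ((x, y) \in L)].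

(* For I inside Inc, each (x, y) in I has x != y, so (y, x) \in L says that
   x > y in L. *)
Definition reversible (I : {set P * P}) : bool :=
  [exists L : {set P * P}, linear_extension L &&
    [forall xy in I, (xy.2, xy.1) \in L]].

(* The partition of Inc into singletons consists of #|Inc| reversible sets, so
   the starting value #|Inc| does not affect the minimum. *)
Definition poset_dim : nat :=
  if Inc == set0 then 1
  else \big[minn/#|Inc|]_(Q : {set {set P * P}} |
          partition Q Inc && [forall I in Q, reversible I]) #|Q|.

End Posets.

(* Main.v *)
Require Import Defs.
From mathcomp Require Import all_boot all_order.
From mathcomp Require Import zify.
From Stdlib Require Import IndefiniteDescription.

Set Implicit Arguments.
Unset Strict Implicit.
Unset Printing Implicit Defensive.

Import Order.TTheory.

(** A set of incomparable pairs is reversible as soon as it carries no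
    alternating cycle, that is, no cyclic sequence of its pairs (x_i, y_i) with
    x_i <= y_{i+1} throughout ([acyclic_reversible]).  So it is enough to give
    each incomparable pair a signature, with few possible values, such that no
    alternating cycle has all its pairs of the same signature.

    Fix a linear order on the elements that witnesses c = wcol_{4h-4}(G), let
    r = h - 1, and color the elements with c colors so that an element differs
    in color from every other one weakly 4r-reachable from it.  A relation x <= y is
    realised by a chain of covers with at most r edges, and its smallest vertex
    z lies between x and y and is weakly r-reachable from both.  Thus, for an
    incomparable pair (x, y), call z above the pair if x <= z, below it if
    z <= y, where z is weakly r-reachable from x, respectively y; no z is both.

    Imagine scanning the vertices in increasing order and guessing, whenever a
    vertex is above or below the pair, which of the two it is, knowing only the
    previous wrong guesses.  Guess by the halving principle: among the pairs
    consistent with the mistakes so far, take the answer that leaves the longer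
    ladder.  A ladder is a sequence of pairs with x_i <= y_j for i < j while x_i
    is not below y_i; a ladder of pairs that z is above, followed by a ladder of pairs that
    z is below, is again a ladder ([max_ladder_split]), so each mistake shortens
    the longest consistent ladder and the number of mistakes is at most the
    length N of the longest ladder ([mistakes_bounded]).

    The length N is bounded in terms of h and the class
    ([ladder_subdivided_clique]).  Along a long ladder one finds t vertices
    p_1, ..., p_t, each joined by a fan of chains to the same large set of
    elements y_j.  They are distinct because p_a, which lies above some x_i in
    the ladder, is not below the y_i with the same index, while the previous
    centres are.  Since a vertex lies on at most one branch of each fan, a greedy choice
    of the y_j gives pairwise disjoint connections p_a - y_j - p_b, one for each
    pair {a, b}: a subdivision of K_t with at most 2h subdivision vertices per
    edge.  A nowhere dense class excludes this for some t.

    The signature of a pair is the list of its mistakes, each described by its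
    color, by whether it is above or below, and by one order comparison with the
    vertex of the same color near the other end of the pair.  There are at most
    (4c + 1)^N signatures, hence the bound (3c)^(2N).  Given an alternating cycle
    with constant signature, let z be the smallest vertex on the chains that
    realise its relations.  Since these chains avoid everything smaller than z,
    they carry a mistake of one pair to the adjacent pair as long as it is at
    most z ([color_rank_transport]); the comparisons in the signature then make a
    quantity monotone around the cycle, hence constant.  So all the pairs of the
    cycle have the same mistakes up to z, and the same guess was made about z for
    all of them.  But z is above one pair and below the next one
    ([signature_no_cycle]). *)

(** * Disjoint subfamilies and fans *)

Lemma card_bigcup_leq (I V : finType) (A : {pred I}) (F : I -> {set V}) :
  #|\bigcup_(i in A) F i| <= \sum_(i in A) #|F i|.
Proof.
elim/big_rec2: _ => [|i n B _ leB]; first by rewrite cards0.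
by have := (cardsUI (F i) B); lia.
Qed.

(** Greedy choice: a member F y meets at most k * D members of the family,
    because each of its at most k elements lies in at most D of them.  So each
    chosen y costs at most k * D + 1 indices. *)
Lemma disjoint_subfamily (I V : finType) (F : I -> {set V}) (k D m : nat) (Y : {set I}) :
  {in Y, forall y, #|F y| <= k} ->
  (forall v, #|[set y in Y | v \in F y]| <= D) ->
  m * (k * D).+1 <= #|Y| ->
  exists2 Z : {set I}, Z \subset Y &
    #|Z| = m /\ {in Z &, forall y z, y != z -> [disjoint F y & F z]}.
Proof.
move=> + + +; elim: m Y => [|m IH] Y Fk FD leY.
  by exists set0; [exact: sub0set | split=> [|y z]; rewrite ?cards0 ?inE].
have [y0 y0Y] : exists y, y \in Y by apply/set0Pn; rewrite -card_gt0; lia.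
pose N := \bigcup_(v in F y0) [set y in Y | v \in F y].
have leN : #|N| <= k * D.
  apply: (leq_trans (card_bigcup_leq _ _)).
  apply: (@leq_trans (\sum_(v in F y0) D)); first exact: leq_sum.
  by rewrite sum_nat_const leq_mul2r Fk ?orbT.
pose Y1 := Y :\: (y0 |: N).
have sY1 : Y1 \subset Y by apply: subsetDl.
have [||| Z sZ [cZ dZ]] := IH Y1.
- by move=> y /(subsetP sY1); apply: Fk.
- move=> v; apply: leq_trans (FD v); apply: subset_leq_card.
  by apply/subsetP=> y; rewrite !inE -andbA => /and3P[_ -> ->].
- have := cardsD Y (y0 |: N); have := subset_leq_card (subsetIr Y (y0 |: N)).
  have := cardsU1 y0 N; rewrite -/Y1; lia.
have y0d z : z \in Z -> z != y0 /\ [disjoint F y0 & F z].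
  move=> /(subsetP sZ); rewrite !inE negb_or => /andP[/andP[-> zN] zY]; split=> //.
  rewrite -setI_eq0; apply: contraR zN => /set0Pn[v /setIP[v0 vz]].
  by apply/bigcupP; exists v; rewrite ?inE ?zY.
exists (y0 |: Z).
  by rewrite subUset sub1set y0Y (subset_trans sZ).
split.
  by rewrite cardsU1 cZ (_ : y0 \notin Z) //; apply/negP=> /y0d[/eqP].
move=> y z /setU1P[->|yZ] /setU1P[->|zZ] //; rewrite ?eqxx //.
- by move=> _; case: (y0d _ zZ).
- by move=> _; rewrite disjoint_sym; case: (y0d _ yZ).
- exact: dZ.
Qed.

Section Fan.
Variables (T : finType) (e : rel T).

(** The branches omit the centre p, so that they can be pairwise disjoint. *)
Definition fan (l : nat) (p : T) (Y : {set T}) (Q : T -> seq T) : Prop :=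
  {in Y, forall y, [/\ path e p (Q y), last p (Q y) = y & size (Q y) <= l]} /\
  {in Y &, forall y z, y != z -> [disjoint Q y & Q z]}.

(** At length 0 the value 2 makes the hypotheses contradictory, as all the
    targets coincide with the starting point. *)
Fixpoint fan_bound (l m : nat) : nat :=
  if l is l'.+1 then m * (l'.+1 * fan_bound l' m).+1 else 2.

Lemma fan_sub l p (Y Z : {set T}) Q : Z \subset Y -> fan l p Y Q -> fan l p Z Q.
Proof.
by move=> /subsetP sZ [Qp Qd]; split=> [y /sZ/Qp | y z /sZ yY /sZ zY]; [|exact: Qd].
Qed.

(** If some vertex lies on many of the paths, restart from that vertex: the
    remaining pieces of these paths are shorter.  Otherwise each vertex lies on
    few paths, and [disjoint_subfamily] selects a fan centred at x itself. *)
Lemma fan_exists l m x (Y : {set T}) :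
    {in Y, forall y, exists s, [/\ path e x s, last x s = y & size s <= l]} ->
    fan_bound l m <= #|Y| ->
  exists p, connect e x p /\ exists2 Z : {set T}, Z \subset Y &
    m <= #|Z| /\ exists Q, fan l p Z Q.
Proof.
elim: l x Y => [|l IH] x Y /= xY leY.
  have: #|Y| <= 1.
    rewrite -(cards1 x); apply/subset_leq_card/subsetP=> y /xY[[|//= a s] [_ <-]] //=.
    by rewrite inE.
  lia.
have [Q Qp] : exists Q : T -> seq T, forall y, y \in Y ->
    [/\ path e x (Q y), last x (Q y) = y & size (Q y) <= l.+1].
  apply: (@fin_all_exists _ _ (fun y s => y \in Y ->
     [/\ path e x s, last x s = y & size s <= l.+1])) => y.
  by case: (boolP (y \in Y)) => [/xY[s ?]|_]; [exists s | exists [::]].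
have [v /andP[/set0Pn[y0] +  vY]|few] := pickP (fun v =>
    ([set y in Y | v \in Q y] != set0) && (fan_bound l m <= #|[set y in Y | v \in Q y]|)).
  rewrite inE => /andP[y0Y vy0].
  have [|//|p [vp [Z sZ [mZ RZ]]]] := IH v [set y in Y | v \in Q y].
    move=> y; rewrite inE => /andP[/Qp[+ + +] vQ].
    case/splitPr: vQ => s1 s2; rewrite cat_path last_cat size_cat /= => /and3P[_ _ ?] ? ?.
    by exists s2; split=> //; lia.
  exists p; split.
    apply: connect_trans vp; have [+ _ _] := Qp y0 y0Y.
    case/splitPr: vy0 => s1 s2; rewrite cat_path /= => /and3P[p1 p2 _].
    by apply/connectP; exists (rcons s1 v); rewrite ?rcons_path ?p1 ?last_rcons.
  exists Z; first by apply: subset_trans sZ _; apply/subsetP=> y; rewrite inE => /andP[].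
  case: RZ => R [RZ Rd]; split=> //; exists R; split=> // y /RZ[? ? ?]; split=> //; lia.
have [||| Z sZ [cZ dZ]] :=
  @disjoint_subfamily T T (fun y => [set v in Q y]) l.+1 (fan_bound l m) m Y.
- by move=> y /Qp[_ _ lQ]; rewrite cardsE (leq_trans (card_size _)).
- move=> v; have := few v.
  have -> : [set y in Y | v \in [set u in Q y]] = [set y in Y | v \in Q y].
    by apply/setP=> y; rewrite !inE.
  by case: eqVneq => [->|_ /=]; rewrite ?cards0 // => /negbT; rewrite -ltnNge => /ltnW.
- by [].
exists x; split=> //; exists Z => //; rewrite cZ; split=> //; exists Q; split.
  by move=> y /(subsetP sZ)/Qp.
move=> y z yZ zZ yz; have := dZ _ _ yZ zZ yz.
by rewrite !disjoint_subset => /subsetP H; apply/subsetP=> v; have := H v; rewrite !inE.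
Qed.
End Fan.

(** * Ladders force subdivided cliques *)

Section Ladder.
Variables (d : Order.disp_t) (P : finPOrderType d).
Implicit Types (x y z : P).

Definition upcover x y := covers y x.

Definition ladder (s : seq (P * P)) :=
  all (fun p => ~~ (p.1 <= p.2)%O) s && pairwise (fun p q => (p.1 <= q.2)%O) s.

Lemma ladder_subseq s1 s2 : subseq s1 s2 -> ladder s2 -> ladder s1.
Proof.
move=> s12 /andP[/allP a2 p2]; rewrite /ladder (subseq_pairwise s12 p2) andbT.
by apply/allP=> p /(mem_subseq s12)/a2.
Qed.

Lemma ladder_uniq s : ladder s -> uniq (map snd s).
Proof.
elim: s => // p s IH; rewrite /ladder /= -!andbA => /and4P[np a al pw].
rewrite IH ?andbT /ladder ?a ?pw //.
by apply/mapP=> -[q /(allP al) /= pq E]; rewrite E pq in np.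
Qed.

Lemma upcover_path_le x s : path upcover x s -> (x <= last x s)%O.
Proof.
elim: s x => //= y s IH x /andP[/andP[xy _] /IH]; exact/le_trans/ltW.
Qed.

Lemma upcover_path_lt x s : path upcover x s -> path (fun x y => x < y)%O x s.
Proof. by apply: sub_path => u v /andP[]. Qed.

Lemma le_upcover_path x y : (x <= y)%O -> exists2 s, path upcover x s & last x s = y.
Proof.
have [n] := ubnP #|[set z | (x <= z <= y)%O]|.
elim: n x y => // n IH x y ltn; rewrite le_eqVlt => /predU1P[->|xy]; first by exists [::].
have [/existsP[z /andP[xz zy]]|nz] := boolP [exists z, (x < z)%O && (z < y)%O]; last first.
  by exists [:: y]; rewrite //= /upcover /covers xy nz.
have [|s1 p1 l1] := IH x z _ (ltW xz).
  rewrite ltnS in ltn; apply: leq_trans ltn; apply: proper_card; apply/properP; split.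
    by apply/subsetP=> u; rewrite !inE => /andP[-> /le_trans->] //; apply: ltW.
  by exists y; rewrite !inE ?lexx ?(ltW xy) //= lt_geF.
have [|s2 p2 l2] := IH z y _ (ltW zy).
  rewrite ltnS in ltn; apply: leq_trans ltn; apply: proper_card; apply/properP; split.
    by apply/subsetP=> u; rewrite !inE => /andP[/(le_trans (ltW xz)) -> ->].
  by exists x; rewrite !inE ?lexx ?(ltW xy) //= (lt_geF xz).
by exists (s1 ++ s2); rewrite ?cat_path ?last_cat ?l1 ?p1.
Qed.

(** The vertices of an upward path form a chain. *)
Lemma upcover_path_size x s : path upcover x s -> size s < height P.
Proof.
move=> /upcover_path_lt xs.
have ss : sorted (fun x y => x < y)%O (x :: s) by [].
have us : uniq (x :: s) := lt_sorted_uniq ss.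
rewrite -[_.+1]/(size (x :: s)) -(card_uniqP us) -cardsE.
rewrite /height (bigD1 [set u in x :: s]) /=; first exact: leq_maxl.
apply/forall_inP=> u; rewrite inE => us'; apply/forall_inP=> v; rewrite inE => vs.
have : pairwise >=<%O (x :: s).
  by move: ss; rewrite lt_sorted_pairwise; apply: sub_pairwise => a b /lt_comparable.
rewrite (pairwise_all2rel comparablexx (fun a b => comparable_sym b a)).
by move=> /allrelP; apply.
Qed.

Lemma le_upcover_path_height h x y : height P <= h -> (x <= y)%O ->
  exists s, [/\ path upcover x s, last x s = y & size s <= h].
Proof.
move=> hP /le_upcover_path[s ps ls]; exists s; split=> //.
by apply: leq_trans hP; apply/ltnW/(upcover_path_size ps).
Qed.

(** The centres are found one after the other; the fan of each must be large
    enough for all the later ones to fit inside it. *)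
Fixpoint multifan_bound (h k m : nat) : nat :=
  if k is k'.+1 then (fan_bound h (multifan_bound h k' m)).+1 else m.

(** The first x is below all the later y's, so it has an upward fan onto many of
    them, with centre p; recurse on the subladder that these y's select.  The
    last conclusion makes the centres distinct: a later centre is above some x of
    the subladder, hence not below the corresponding y, whereas p is. *)
Lemma multifan h k m (s : seq (P * P)) :
    height P <= h -> ladder s -> multifan_bound h k m <= size s ->
  exists (ps : seq P) (Y : {set P}) (Q : P -> P -> seq P),
    [/\ size ps = k /\ uniq ps, m <= #|Y|, {subset Y <= map snd s},
        {in ps, forall p, fan upcover h p Y (Q p)}
      & {in ps, forall p, exists2 q, q \in s & (q.1 <= p)%O}].
Proof.
move=> hP; elim: k s => [|k IH] s.
  move=> /ladder_uniq us ms; exists [::], [set y in map snd s], (fun _ _ => [::]).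
  split=> //; last by move=> y; rewrite inE.
  by rewrite cardsE (card_uniqP us) size_map.
case: s => // -[x1 y1] s lad; rewrite [multifan_bound _ _ _]/= ltnS => les.
have lads : ladder s by apply: ladder_subseq lad; apply: subseq_cons.
have us := ladder_uniq lads.
have le1 y : y \in map snd s -> (x1 <= y)%O.
  case/mapP=> q qs ->; case/andP: lad => _ /= /andP[/allP al _]; exact: (al q qs).
have [||p [x1p [Z sZ [leZ [R RZ]]]]] :=
  @fan_exists _ upcover h (multifan_bound h k m) x1 [set y in map snd s].
- move=> y; rewrite inE => /le1; exact: le_upcover_path_height.
- by rewrite cardsE (card_uniqP us) size_map.
have {}x1p : (x1 <= p)%O.
  by have /connectP[t /upcover_path_le + ->] := x1p.
pose s' := [seq q <- s | q.2 \in Z].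
have lads' : ladder s' by apply: ladder_subseq lads; apply: filter_subseq.
have Zs' y : y \in Z -> y \in map snd s'.
  move=> yZ; have := subsetP sZ _ yZ; rewrite inE => /mapP[q qs E]; apply/mapP.
  by exists q; rewrite // mem_filter -E yZ.
have [|ps [Y [Q [[cps ups] mY sY Qf bel]]]] := IH s' lads'.
  rewrite -(size_map snd) -(card_uniqP (ladder_uniq lads')); apply: leq_trans leZ _.
  by apply/subset_leq_card/subsetP=> y /Zs'.
have YZ : Y \subset Z.
  by apply/subsetP=> y /sY /mapP[q]; rewrite mem_filter => /andP[? _] ->.
have pps : p \notin ps.
  apply/negP=> /bel[q]; rewrite mem_filter => /andP[qZ qs] qp.
  have [py _ _] := RZ.1 _ qZ.
  have [_ ly _] := RZ.1 _ qZ; have := upcover_path_le py; rewrite ly => /(le_trans qp).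
  by apply/negP; case/andP: lads => /allP/(_ q qs).
have Qps p' : p' \in ps -> (p' == p) = false.
  by move=> p'ps; apply: contraNF pps => /eqP <-.
exists (p :: ps), Y, (fun p' => if p' == p then R else Q p'); split=> //.
- by rewrite /= cps pps.
- move=> y /sY; rewrite inE => yz; apply/orP; right; move: yz; apply: mem_subseq.
  exact/map_subseq/filter_subseq.
- move=> p'; rewrite inE; case: eqVneq => [->|_ /= /Qf //] _; exact: fan_sub YZ RZ.
- move=> p' /predU1P[->|/bel[q]]; first by exists (x1, y1); rewrite ?inE ?eqxx.
  by rewrite mem_filter => /andP[_ qs] qp; exists q; rewrite // inE qs orbT.
Qed.

(** The first summand t * t pays for the common targets with a branch that runs
    through a centre.  The second one leaves, by [disjoint_subfamily], t * t
    targets with pairwise disjoint branches, one for each pair of centres. *)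
Definition ladder_bound (h t : nat) : nat :=
  multifan_bound h t (t * t + t * t * (t * h * t).+1).

(** For i < j, the centres b i and b j are joined through a private target
    c (i, j), up the branch of the one fan and down that of the other.  The two
    branches may meet earlier; shortening the walk takes care of that. *)
Lemma ladder_subdivided_clique (P_gt0 : 0 < #|P|) h t (s : seq (P * P)) :
    height P <= h -> ladder s -> ladder_bound h t <= size s ->
  has_subdivided_clique h.*2 t (cover_graph P_gt0).
Proof.
move=> hP lad /(multifan hP lad)[ps [Y [Q [[cps ups] leY _ Qf _]]]].
have [p0 _] : exists p0 : P, p0 \in P by apply/card_gt0P.
pose b (i : 'I_t) : P := nth p0 ps i.
have bps i : b i \in ps by rewrite mem_nth ?cps.
(* all the vertices on the branches that lead to y *)
pose F (y : P) := \bigcup_(p in ps) [set v in Q p y].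
have FD (W : {set P}) v : W \subset Y -> #|[set y in W | v \in F y]| <= t.
  move=> /subsetP WY.
  apply: (@leq_trans #|\bigcup_(p in ps) [set y in W | v \in Q p y]|).
    apply/subset_leq_card/subsetP=> y; rewrite inE => /andP[yW /bigcupP[p pps]].
    by rewrite inE => vQ; apply/bigcupP; exists p; rewrite // inE yW.
  apply: (leq_trans (card_bigcup_leq _ _)).
  rewrite -cps -(card_uniqP ups) -sum1_card; apply: leq_sum => p pps.
  rewrite leqNgt; apply/negP=> /card_gt1P[y [z []]]; rewrite !inE.
  move=> /andP[/WY yY vy] /andP[/WY zY vz] yz.
  by have := (Qf _ pps).2 _ _ yY zY yz; rewrite disjoint_has => /hasP[]; exists v.
pose bad := \bigcup_(v in ps) [set y in Y | v \in F y].
have lebad : #|bad| <= t * t.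
  apply: (leq_trans (card_bigcup_leq _ _)).
  apply: (@leq_trans (\sum_(v in ps) t)); first by apply: leq_sum => v _; apply: FD.
  by rewrite sum_nat_const (card_uniqP ups) cps.
have [||| Z sZ [cZ dZ]] := @disjoint_subfamily _ _ F (t * h) t (t * t) (Y :\: bad).
- move=> y /setDP[yY _]; apply: (leq_trans (card_bigcup_leq _ _)).
  apply: (@leq_trans (\sum_(v in ps) h)).
    apply: leq_sum => p pps; rewrite cardsE (leq_trans (card_size _)) //.
    by have [_ _] := (Qf _ pps).1 _ yY.
  by rewrite sum_nat_const (card_uniqP ups) cps.
- by move=> v; apply: FD; apply: subsetDl.
- by have := cardsD Y bad; have := subset_leq_card (subsetIr Y bad); lia.
have [c [cinj cZ']] : exists c : 'I_t * 'I_t -> P, injective c /\ forall ij, c ij \in Z.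
  have cc : #|{: 'I_t * 'I_t}| = #|Z| by rewrite card_prod !card_ord cZ.
  exists (fun ij => enum_val (cast_ord cc (enum_rank ij))); split=> [i j|ij].
    by move=> /enum_val_inj/cast_ord_inj/enum_rank_inj.
  exact: enum_valP.
have ZF y v : y \in Z -> v \in ps -> v \notin F y.
  move=> /(subsetP sZ)/setDP[yY nb] vps; apply: contra nb => vF.
  by apply/bigcupP; exists v; rewrite // inE yY.
have binj : injective b.
  by move=> i j /eqP; rewrite nth_uniq ?cps // => /eqP/val_inj.
pose G := cover_graph P_gt0.
have link (i j : 'I_t) : exists w : seq P, i < j ->
    [/\ path (@adj G) (b i) (rcons w (b j)), uniq w, size w <= h.*2
      & {subset w <= F (c (i, j))}].
  have [ij|_] := boolP (i < j); last by exists [::].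
  pose y := c (i, j); have yZ : y \in Z by apply: cZ'.
  have yY : y \in Y by have /(subsetP sZ)/setDP[] := yZ.
  have [pi li si] := (Qf _ (bps i)).1 _ yY; have [pj lj sj] := (Qf _ (bps j)).1 _ yY.
  pose w0 := Q (b i) y ++ rev (belast (b j) (Q (b j) y)).
  have Fw k u : u \in Q (b k) y -> u \in F y.
    by move=> uQ; apply/bigcupP; exists (b k); rewrite ?inE.
  have bij : b i != b j by rewrite (inj_eq binj) -val_eqE neq_ltn ij.
  have pw0 : path (@adj G) (b i) w0.
    rewrite cat_path li; apply/andP; split; last first.
      have := rev_path (@adj G) (b j) (Q (b j) y); rewrite lj => ->.
      by apply: sub_path pj => u v; rewrite /= /cover_adj /upcover => ->.
    by apply: sub_path pi => u v; rewrite /= /cover_adj /upcover => ->; rewrite orbT.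
  have lw0 : last (b i) w0 = b j.
    rewrite last_cat li; case: (Q (b j) y) lj => [/= <- //|a r] _ /=.
    by rewrite rev_cons last_rcons.
  have sw0 : size w0 <= h.*2 by rewrite size_cat size_rev size_belast -addnn leq_add.
  have mw0 u : u \in w0 -> u != b j -> u \in F y.
    rewrite mem_cat mem_rev => /orP[/Fw //|/mem_belast].
    by rewrite inE => /predU1P[->|/Fw //]; rewrite eqxx.
  case: (shortenP pw0) lw0 => w1 pw1 uw1 w10 lw1.
  case/lastP: w1 lw1 pw1 uw1 w10 => [/= E|w z]; first by rewrite E eqxx in bij.
  rewrite last_rcons => -> pw uw sub; exists w => _.
  have {}uw : uniq (rcons w (b j)) by case/andP: uw.
  have lew := uniq_leq_size uw sub.
  have := uw; rewrite rcons_uniq => /andP[zw {}uw]; split=> //.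
    by apply: leq_trans sw0; apply: leq_trans lew; rewrite size_rcons.
  move=> u uw'; apply: mw0; first by apply: sub; rewrite mem_rcons inE uw' orbT.
  by apply: contraNneq zw => <-.
have [f fP] := fin_all_exists (fun i => fin_all_exists (link i)).
exists b, f; split=> //.
- by move=> i j /(fP i j)[].
- move=> i j k /(fP i j)[_ _ _ sF]; apply/negP=> /sF; apply/negP.
  by apply: ZF; rewrite ?cZ'.
- move=> i j k l /(fP i j)[_ _ _ sF] /(fP k l)[_ _ _ sF'] ne.
  have := dZ _ _ (cZ' (i, j)) (cZ' (k, l)); rewrite (inj_eq cinj) => /(_ ne) dF.
  rewrite disjoint_has; apply/hasPn=> u /sF uF; apply/negP=> /sF' uF'.
  by move: dF; rewrite disjoint_subset => /subsetP/(_ _ uF); rewrite inE uF'.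
Qed.

End Ladder.

(** * Weak reachability and the coloring *)

Section LinearOrder.
Variables (T : finType) (L : {set T * T}).

(** Replacing the order by this injective numbering turns every comparison of
    vertices into arithmetic on natural numbers. *)
Definition rank (v : T) : nat := #|[set u | (u, v) \in L]|.

Hypothesis linL : linear_order L.

Lemma rankE u v : ((u, v) \in L) = (rank u <= rank v).
Proof.
case/and3P: linL => /forallP tot /forallP asym /forallP tr.
have trL a b c : (a, b) \in L -> (b, c) \in L -> (a, c) \in L.
  by move=> ab bc; have /forallP/(_ b)/forallP/(_ c) := tr a; rewrite ab bc.
apply/idP/idP=> [uv|]; first by apply/subset_leq_card/subsetP=> w; rewrite !inE => /trL; exact.
apply: contraTT => nuv; rewrite -ltnNge.
have vu : (v, u) \in L by have /forallP/(_ v) := tot u; rewrite (negPf nuv).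
apply/proper_card/properP; split; first by apply/subsetP=> w; rewrite !inE => /trL; exact.
by exists u; rewrite !inE ?(negPf nuv) //; have /forallP/(_ u) := tot u; rewrite orbb.
Qed.

Lemma rank_inj : injective rank.
Proof.
move=> u v E; case/and3P: linL => _ /forallP/(_ u)/forallP/(_ v) + _.
by rewrite !rankE E leqnn => /eqP.
Qed.
End LinearOrder.

(** The order is lexicographic: by f, then by the enumeration of T. *)
Lemma linear_order_of_rank (T : finType) (f : T -> nat) :
  exists2 L : {set T * T}, linear_order L & forall u v, f u < f v -> (u, v) \in L.
Proof.
pose key u := f u * #|T| + enum_rank u.
have keyE u v : f u < f v -> key u < key v.
  move=> uv; apply: leq_trans (leq_addr _ _); apply: leq_trans (leq_mul uv (leqnn _)).
  by rewrite mulSn /key addnC ltn_add2r.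
have key_inj u v : key u = key v -> u = v.
  move=> E; apply/enum_rank_inj/val_inj => /=.
  case: (ltngtP (f u) (f v)) => [/keyE|/keyE|fuv]; rewrite ?E ?ltnn //.
  by move: E; rewrite /key fuv => /addnI.
exists [set uv | key uv.1 <= key uv.2]; last first.
  by move=> u v /keyE/ltnW; rewrite inE.
apply/and3P; split.
- by apply/forallP=> u; apply/forallP=> v; rewrite !inE /= leq_total.
- apply/forallP=> u; apply/forallP=> v; rewrite !inE /= -eqn_leq.
  by apply/implyP=> /eqP/key_inj ->.
- apply/forallP=> u; apply/forallP=> v; apply/forallP=> w; rewrite !inE /=.
  by apply/implyP=> /andP[]; apply: leq_trans.
Qed.

Lemma bigmin_inf (I : finType) (P : pred I) (F : I -> nat) n0 j :
  P j -> \big[minn/n0]_(i | P i) F i <= F j.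
Proof.
move=> Pj; have := mem_index_enum j; elim: (index_enum I) => // i r IH.
rewrite inE big_cons; case: eqVneq => [<- _|_ /= /IH le]; first by rewrite Pj geq_minl.
by case: ifP => // _; rewrite geq_min le orbT.
Qed.

Lemma greedy_coloring (T : finType) (B : T -> {set T}) (f : T -> nat) (c : nat) :
    (forall v u, u \in B v -> u != v -> f u < f v) ->
    (forall v, #|B v :\ v| < c) ->
  exists phi : T -> 'I_c, forall v u, u \in B v -> u != v -> phi u != phi v.
Proof.
move=> Bf Bc.
have [v0 _|T0] := pickP (@predT T); last first.
  have phi (v : T) : 'I_c by have := T0 v.
  by exists phi => v; have := T0 v.
suff col n : exists phi : T -> 'I_c,
    forall v u, f v < n -> u \in B v -> u != v -> phi u != phi v.
  have [phi phiP] := col (\max_v f v).+1; exists phi => v u; apply: phiP.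
  by rewrite ltnS (leq_bigmax (F := f)).
elim: n => [|n [phi IH]].
  by exists (fun=> Ordinal (leq_ltn_trans (leq0n _) (Bc v0))).
have free v : exists a : 'I_c, a \notin phi @: (B v :\ v).
  have [a aP|full] := pickP (fun a : 'I_c => a \notin phi @: (B v :\ v)); first by exists a.
  have := leq_ltn_trans (leq_imset_card phi _) (Bc v).
  rewrite (_ : phi @: _ = setT) ?cardsT ?card_ord ?ltnn //.
  by apply/setP=> a; rewrite in_setT; have /negbFE := full a.
have [psi psiP] := fin_all_exists free.
exists (fun v => if f v == n then psi v else phi v) => v u.
rewrite ltnS leq_eqVlt => fv uB uv; have fuv := Bf _ _ uB uv.
case: eqVneq fv => /= [fvn _|_ fvn]; last first.
  by rewrite (ltn_eqF (ltn_trans fuv fvn)); apply: IH.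
rewrite -fvn (ltn_eqF fuv); apply: contraNneq (psiP v) => <-.
by apply: imset_f; rewrite !inE uv.
Qed.

Section WeakReach.
Variables (G : sgraph) (rk : G -> nat).

(** Keeping the lower bound k on the ranks separate from the end vertices makes
    this relation symmetric and composable, unlike weak reachability, which is
    the case k = rk u ([WReachE]). *)
Definition walk (r k : nat) (v u : G) : bool :=
  [exists i : 'I_r.+1, exists s : i.-tuple G,
    [&& path (@adj G) v s, last v s == u & all (fun w => k <= rk w) (v :: s)]].

Lemma walkP r k v u :
  reflect (exists s, [/\ path (@adj G) v s, last v s = u, size s <= r
                       & all (fun w => k <= rk w) (v :: s)])
          (walk r k v u).
Proof.
apply: (iffP existsP) => [[i /existsP[s /and3P[ps /eqP ls as_]]]|[s [ps ls ss as_]]].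
  by exists s; split=> //; rewrite size_tuple -ltnS.
have lt : size s < r.+1 by [].
by exists (Ordinal lt); apply/existsP; exists (in_tuple s); rewrite ps as_ ls eqxx.
Qed.

Lemma walk_refl r v : walk r (rk v) v v.
Proof. by apply/walkP; exists [::]; rewrite /= leqnn. Qed.

Lemma walk_sym r k v u : walk r k v u -> walk r k u v.
Proof.
move=> /walkP[s [ps <- ss as_]]; apply/walkP; exists (rev (belast v s)); split.
- by rewrite rev_path; apply: sub_path ps => a b; rewrite /= adj_sym.
- by case: s {ps ss as_} => //= a s; rewrite rev_cons last_rcons.
- by rewrite size_rev size_belast.
- apply/allP=> w; rewrite inE mem_rev => /predU1P[->|/mem_belast]; apply: (allP as_).
  exact: mem_last.
Qed.

Lemma walk_trans r1 r2 k v w u :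
  walk r1 k v w -> walk r2 k w u -> walk (r1 + r2) k v u.
Proof.
move=> /walkP[s1 [p1 l1 z1 a1]] /walkP[s2 [p2 l2 z2 a2]]; apply/walkP.
exists (s1 ++ s2); split; rewrite ?cat_path ?last_cat ?size_cat ?l1 ?p1 ?leq_add //.
by rewrite -cat_cons all_cat a1 /=; case/andP: a2.
Qed.

Lemma walk_weaken r1 r2 k1 k2 v u :
  r1 <= r2 -> k2 <= k1 -> walk r1 k1 v u -> walk r2 k2 v u.
Proof.
move=> r12 k21 /walkP[s [ps ls ss as_]]; apply/walkP; exists s; split=> //.
  exact: leq_trans r12.
by apply: sub_all as_ => w; apply: leq_trans.
Qed.

Lemma walk_rank_r r k v u : walk r k v u -> k <= rk u.
Proof. by move=> /walkP[s [_ <- _ /allP as_]]; apply/as_/mem_last. Qed.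

Lemma walk_rank_l r k v u : walk r k v u -> k <= rk v.
Proof. by move=> /walk_sym/walk_rank_r. Qed.
End WeakReach.

Lemma WReachE (G : sgraph) (pi : {set G * G}) r v u : linear_order pi ->
  (u \in WReach pi r v) = walk (rank pi) r (rank pi u) v u.
Proof.
move=> lin; rewrite inE; apply/existsP/walkP => [[i /existsP[s]]|[s [ps ls ss as_]]].
  case/and4P=> ps _ /eqP ls /allP as_; exists s; rewrite size_tuple -ltnS ltn_ord; split=> //.
  by apply/allP=> w /as_; rewrite rankE.
case: (shortenP ps) ls => s' ps' us' sub ls.
have lt : size s' < r.+1.
  by rewrite ltnS; apply: leq_trans ss; apply: uniq_leq_size sub; case/andP: us'.
exists (Ordinal lt); apply/existsP; exists (in_tuple s').
apply/and4P; split; rewrite ?ls //; apply/allP=> w w'; rewrite rankE //.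
by apply: (allP as_); move: w'; rewrite !inE => /predU1P[->|/sub ->]; rewrite ?eqxx ?orbT.
Qed.

(** Vertices are colored by increasing rank, avoiding the colors of the other
    weakly reachable vertices, of which there are fewer than wcol G r. *)
Lemma wcol_coloring (G : sgraph) (r : nat) :
  0 < wcol G r /\
  exists (rk : G -> nat) (phi : G -> 'I_(wcol G r)), injective rk /\
    forall v u, walk rk r (rk u) v u -> u != v -> phi u != phi v.
Proof.
have [pi lin lepi] : exists2 pi : {set G * G}, linear_order pi &
    forall v, #|WReach pi r v| <= wcol G r.
  have [L linL _] := linear_order_of_rank (fun v : G => 0).
  rewrite /wcol; elim/big_rec: _ => [|pi n lin [pi' lin' le']].
    by exists L => // v; apply: max_card.
  case: (leqP (\max_v #|WReach pi r v|) n) => _; last by exists pi'.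
  by exists pi => // v; apply: (leq_bigmax (F := fun v => #|WReach pi r v|)).
have self v : v \in WReach pi r v by rewrite WReachE // walk_refl.
split.
  have [v _] : exists v : G, v \in G by apply/card_gt0P; apply: vertex_gt0.
  by apply: leq_trans (lepi v); rewrite card_gt0; apply/set0Pn; exists v.
have [v u|v|phi phiP] := @greedy_coloring G (WReach pi r) (rank pi) (wcol G r).
- rewrite WReachE // => /walk_rank_l; rewrite leq_eqVlt => /predU1P[/(rank_inj lin) ->|//].
  by rewrite eqxx.
- by have := lepi v; rewrite (cardsD1 v) self.
exists (rank pi), phi; split; first exact: rank_inj.
by move=> v u; rewrite -WReachE //; apply: phiP.
Qed.

(** * Reversible sets and alternating cycles *)

Section Reversible.
Variables (d : Order.disp_t) (P : finPOrderType d).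
Implicit Types (I : {set P * P}) (x y : P).

Definition alternating I : rel (P * P) :=
  fun p q => [&& p \in I, q \in I & (p.1 <= q.2)%O].

(** Add to the order of P the relations y < x for all (x, y) in I.  The
    transitive closure T is antisymmetric because a loop in it would be an
    alternating cycle, and numbering each element by the size of its set of
    T-predecessors gives a linear extension that reverses I. *)
Lemma acyclic_reversible I :
  (forall p q, connect (alternating I) p q -> ~~ alternating I q p) -> reversible I.
Proof.
move=> acyc.
pose T x y := (x <= y)%O || [exists p, exists q,
  [&& p \in I, q \in I, (x <= p.2)%O, connect (alternating I) p q & (q.1 <= y)%O]].
have viaT p q x y : p \in I -> q \in I -> (x <= p.2)%O -> connect (alternating I) p q ->
    (q.1 <= y)%O -> T x y.
  by move=> *; apply/orP; right; apply/existsP; exists p; apply/existsP; exists q; apply/and5P.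
have T_trans x y z : T x y -> T y z -> T x z.
  case/orP=> [xy|/existsP[p /existsP[q /and5P[pI qI xp pq qy]]]].
    case/orP=> [yz|/existsP[p /existsP[q /and5P[pI qI yp pq qz]]]].
      by rewrite /T (le_trans xy yz).
    by apply: (viaT p q) => //; apply: le_trans yp.
  case/orP=> [yz|/existsP[p' /existsP[q' /and5P[pI' qI' yp' pq' qz']]]].
    by apply: (viaT p q) => //; apply: le_trans yz.
  apply: (viaT p q') => //; apply: connect_trans pq'; apply: connect_trans pq _.
  by apply: connect1; rewrite /alternating qI pI' (le_trans qy).
have T_anti x y : T x y -> T y x -> x = y.
  case/orP=> [xy|/existsP[p /existsP[q /and5P[pI qI xp pq qy]]]].
    case/orP=> [yx|/existsP[p /existsP[q /and5P[pI qI yp pq qx]]]].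
      by apply/le_anti; rewrite xy.
    by have := acyc _ _ pq; rewrite /alternating qI pI (le_trans qx (le_trans xy yp)).
  case/orP=> [yx|/existsP[p' /existsP[q' /and5P[pI' qI' yp' pq' qx']]]].
    by have := acyc _ _ pq; rewrite /alternating qI pI (le_trans qy (le_trans yx xp)).
  have pq2 : connect (alternating I) p q'.
    apply: connect_trans pq'; apply: connect_trans pq _.
    by apply: connect1; rewrite /alternating qI pI' (le_trans qy).
  by have := acyc _ _ pq2; rewrite /alternating qI' pI (le_trans qx' xp).
pose f x := #|[set y | T y x]|.
have fT x y : T x y -> x != y -> f x < f y.
  move=> xy ne; apply/proper_card/properP; split.
    by apply/subsetP=> z; rewrite !inE => /T_trans; exact.
  by exists y; rewrite !inE ?/T ?lexx //; apply: contraNN ne => /(T_anti _ _ xy) ->.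
have [L linL Lf] := linear_order_of_rank f.
apply/existsP; exists L; rewrite /linear_extension linL /=; apply/andP; split.
  apply/forallP=> x; apply/forallP=> y; apply/implyP=> xy.
  have [->|ne] := eqVneq x y.
    by case/and3P: linL => /forallP/(_ y)/forallP/(_ y); rewrite orbb.
  by apply/Lf/fT => //; rewrite /T xy.
apply/forall_inP=> -[x y] xyI /=; apply/Lf/fT.
  exact: (viaT (x, y) (x, y)).
apply/negP=> /eqP yx; have := acyc (x, y) (x, y) (connect0 _ _).
by rewrite /alternating xyI /= yx lexx.
Qed.

Lemma poset_dim_leq (S : finType) (sig : P * P -> S) :
    0 < #|S| -> (forall s, reversible [set p in Inc P | sig p == s]) ->
  poset_dim P <= #|S|.
Proof.
move=> S0 rev; rewrite /poset_dim; case: eqP => // _.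
pose Q := preim_partition sig (Inc P).
have QE : Q = (fun s => [set p in Inc P | sig p == s]) @: (sig @: Inc P).
  rewrite -imset_comp; apply: eq_in_imset => p pI.
  by apply/setP=> q; rewrite !inE eq_sym.
apply: (@leq_trans #|Q|).
  apply: (@bigmin_inf _ _ (fun Q : {set {set P * P}} => #|Q|)).
  rewrite preim_partitionP; apply/forall_inP=> I; rewrite QE => /imsetP[s _ ->].
  exact: rev.
by rewrite QE (leq_trans (leq_imset_card _ _)) // max_card.
Qed.
End Reversible.

(** * Periodic and truncated sequences *)

Lemma monotone_periodic_const (t : nat -> nat) n :
    (forall i, t i.+1 <= t i) \/ (forall i, t i <= t i.+1) ->
    (forall i, t (i + n.+1) = t i) ->
  forall i, t i = t 0.
Proof.
move=> mono per i.
have perM k : t (k * n.+1) = t 0 by elim: k => // k IH; rewrite mulSn addnC per.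
have le_i : i <= i * n.+1 by apply: leq_pmulr.
apply/eqP; rewrite eqn_leq; case: mono => [dec|inc].
  have homo := homo_leq (r := fun a b => b <= a) leqnn (fun _ _ _ ab bc => leq_trans bc ab) dec.
  by rewrite (homo 0) // -(perM i) (homo i).
have homo := homo_leq (r := fun a b => a <= b) leqnn (fun _ _ _ => @leq_trans _ _ _) inc.
by rewrite (homo 0) // -(perM i) (homo i).
Qed.

Lemma filter_truncated_eq (T : eqType) (f : T -> nat) k (x0 : T) (s1 s2 : seq T) :
    size s1 = size s2 ->
    (forall j, j < size s1 -> minn (f (nth x0 s1 j)) k = minn (f (nth x0 s2 j)) k) ->
    (forall j, j < size s1 -> f (nth x0 s1 j) = f (nth x0 s2 j) -> nth x0 s1 j = nth x0 s2 j) ->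
  [seq x <- s1 | f x < k] = [seq x <- s2 | f x < k].
Proof.
elim: s1 s2 => [|a s1 IH] [|b s2] //= [sz] mn inj.
rewrite (IH s2) //; last 2 first.
- by move=> j lt; apply: (mn j.+1).
- by move=> j lt; apply: (inj j.+1).
have := mn 0 isT; have := inj 0 isT; rewrite /= => eqab mab.
have -> : (f b < k) = (f a < k) by lia.
by case: ifP => // lt; rewrite eqab //; lia.
Qed.

Lemma eq_from_onth_bounded (T : Type) N (s1 s2 : seq T) :
  size s1 <= N -> size s2 <= N -> (forall i, i < N -> onth s1 i = onth s2 i) -> s1 = s2.
Proof.
elim: N s1 s2 => [|N IH] [|a s1] [|b s2] //= l1 l2 eqs; try by have := eqs 0 isT.
have [->] : Some a = Some b by exact: (eqs 0 isT).
by congr (_ :: _); apply: IH => // i lt; apply: (eqs i.+1).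
Qed.

(** * Guessing with few mistakes *)

Section Prediction.
Variables (d : Order.disp_t) (P : finPOrderType d) (P_gt0 : 0 < #|P|).
Let G := cover_graph P_gt0.
Variables (N r c : nat) (rk : P -> nat) (phi : P -> 'I_c).
Hypothesis ladderN : forall s : seq (P * P), ladder s -> size s <= N.
Hypothesis heightP : height P <= r.+1.
Hypothesis rk_inj : injective rk.
Local Notation walk := (@walk G rk).
Hypothesis phi_sep : forall v u, walk (4 * r) (rk u) v u -> u != v -> phi u != phi v.
Implicit Types (x y z u v w : P) (p q : P * P) (M : seq (P * bool)).

(** Take a chain of covers from x to y and its vertex z of least rank. *)
Lemma le_walk x y : (x <= y)%O ->
  exists z, [/\ (x <= z)%O, (z <= y)%O, walk r (rk z) x z, walk r (rk z) y z
              & walk r (rk z) x y].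
Proof.
move=> /le_upcover_path[s ps ls].
have ss : size s <= r by rewrite -ltnS; apply: leq_trans heightP; apply: upcover_path_size ps.
pose z := [arg min_(z < x | z \in x :: s) rk z].
have [zs zmin] : z \in x :: s /\ all (fun u => rk z <= rk u) (x :: s).
  rewrite /z; case: arg_minnP => [|z' z's min]; first exact: mem_head.
  by split=> //; apply/allP.
have adjG : subrel (@upcover _ P) (@adj G).
  by move=> u v; rewrite /= /cover_adj /upcover => ->; rewrite orbT.
have wxy : walk r (rk z) x y.
  by apply/walkP; exists s; split=> //; apply: sub_path ps.
exists z; move: zs ps ls ss zmin; move: z {wxy} (wxy) => z wxy zs.
case/splitPl: zs => s1 s2 l1; rewrite cat_path last_cat l1 size_cat => /andP[p1 p2] l2 ss.
rewrite -cat_cons all_cat => /andP[a1 a2]; split=> //.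
- by rewrite -l1 upcover_path_le.
- by rewrite -l2 upcover_path_le.
- apply/walkP; exists s1; split=> //; [exact: sub_path p1 | exact: leq_trans (leq_addr _ _) ss].
apply: walk_sym; apply/walkP; exists s2; split=> //.
- exact: sub_path p2.
- exact: leq_trans (leq_addl _ _) ss.
by rewrite /= leqnn.
Qed.

(** [above] and [below] record both the position of z in the poset and its weak
    r-reachability from the relevant end of the pair. *)
Definition above p z := (p.1 <= z)%O && walk r (rk z) p.1 z.
Definition below p z := (z <= p.2)%O && walk r (rk z) p.2 z.

Lemma IncNle p : p \in Inc P -> ~~ (p.1 <= p.2)%O.
Proof. by rewrite inE => /negP np; apply/negP=> le; apply: np; rewrite /Order.comparable le. Qed.

Lemma above_below p z : p \in Inc P -> above p z -> ~~ below p z.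
Proof.
move=> /IncNle pI /andP[xz _]; apply: contra pI => /andP[zy _]; exact: le_trans zy.
Qed.

(** A pair (z, b) in M asserts that z is above the pair under consideration when
    b is true, and below it when b is false. *)
Definition consistent M : {set P * P} :=
  [set p in Inc P | all (fun m => if m.2 then (p.1 <= m.1)%O else (m.1 <= p.2)%O) M].

Definition max_ladder (S : {set P * P}) : nat :=
  \max_(n < N.+1 | [exists s : n.-tuple (P * P), ladder s && all (mem S) s]) n.

Lemma leq_max_ladder (S : {set P * P}) s : ladder s -> {subset s <= S} -> size s <= max_ladder S.
Proof.
move=> lad /allP sS; have lt : size s < N.+1 by rewrite ltnS ladderN.
apply: (@leq_bigmax_cond _ _ (fun n : 'I_N.+1 => n : nat) (Ordinal lt)).
by apply/existsP; exists (in_tuple s); rewrite lad.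
Qed.

Lemma max_ladder_witness (S : {set P * P}) :
  exists s, [/\ ladder s, {subset s <= S} & size s = max_ladder S].
Proof.
rewrite /max_ladder; elim/big_ind: _ => [|a b|n /existsP[s /andP[lad /allP sS]]].
- by exists [::].
- by case: (leqP a b).
- by exists s; rewrite size_tuple.
Qed.

Lemma max_ladder_gt0 (S : {set P * P}) p : p \in Inc P -> p \in S -> 0 < max_ladder S.
Proof.
move=> /IncNle pI pS; apply: (@leq_max_ladder S [:: p]); first by rewrite /ladder /= pI.
by move=> q; rewrite inE => /eqP->.
Qed.

(** If z is above p and below q, then p.1 <= z <= q.2, so ladders for the two
    answers about z can be concatenated. *)
Lemma max_ladder_split M z :
  max_ladder (consistent ((z, true) :: M)) + max_ladder (consistent ((z, false) :: M))
    <= max_ladder (consistent M).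
Proof.
have [s [/andP[sa sp] sS <-]] := max_ladder_witness (consistent ((z, true) :: M)).
have [t [/andP[ta tp] tS <-]] := max_ladder_witness (consistent ((z, false) :: M)).
rewrite -size_cat; apply: leq_max_ladder.
  rewrite /ladder all_cat sa ta pairwise_cat sp tp !andbT /=.
  apply/allrelP=> p q /sS + /tS; rewrite !inE /= => /and3P[_ pz _] /and3P[_ zq _].
  exact: le_trans zq.
by move=> p; rewrite mem_cat => /orP[/sS|/tS]; rewrite !inE /= => /and3P[-> _ ->].
Qed.

Definition predict M z : bool :=
  max_ladder (consistent ((z, false) :: M)) <= max_ladder (consistent ((z, true) :: M)).

(** No guess is tested on a vertex that is neither above nor below p: either
    answer is harmless there.  The latest mistake comes first. *)
Definition extend_mistakes p M z : seq (P * bool) :=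
  if above p z && ~~ predict M z then (z, true) :: M
  else if below p z && predict M z then (z, false) :: M
  else M.

Fixpoint mistakes p n : seq (P * bool) :=
  if n is n'.+1 then
    if [pick z | rk z == n'] is Some z then extend_mistakes p (mistakes p n') z
    else mistakes p n'
  else [::].

Lemma mistakesP p n : {in mistakes p n, forall m, rk m.1 < n /\
  if m.2 then above p m.1 else below p m.1}.
Proof.
elim: n => //= n IH m.
have IH' : m \in mistakes p n -> rk m.1 < n.+1 /\ if m.2 then above p m.1 else below p m.1.
  by move=> /IH[/ltnW].
case: pickP => // z /eqP rz; rewrite /extend_mistakes.
case: ifP => [/andP[ab _]|_]; last case: ifP => [/andP[be _]|_] //.
  by rewrite inE => /predU1P[->|//] /=; rewrite rz.
by rewrite inE => /predU1P[->|//] /=; rewrite rz.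
Qed.

(** The mistakes made before rank n can be read off from any longer record; this
    allows pairs to be compared through their complete records. *)
Lemma mistakes_filter p n k : n <= k -> mistakes p n = [seq m <- mistakes p k | rk m.1 < n].
Proof.
move=> /subnK <-; elim: (k - n) => [|i IH].
  by rewrite add0n; apply/esym/all_filterP/allP=> m /mistakesP[].
rewrite addSn /= {1}IH; case: pickP => // z /eqP rz; rewrite /extend_mistakes.
have zn : (rk z < n) = false by rewrite rz ltnNge leq_addl.
by case: ifP => _ /=; [rewrite zn | case: ifP => _ /=; rewrite ?zn].
Qed.

(** The answer that contradicts the guess leaves a ladder no longer than the
    guessed one, and a nonempty one, since p itself is consistent with it.  As
    the two ladders together are no longer than the longest ladder before the
    guess, the length of the longest ladder drops with every mistake. *)
Lemma mistakes_bounded p n : p \in Inc P ->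
  p \in consistent (mistakes p n) /\
  size (mistakes p n) + max_ladder (consistent (mistakes p n)) <= N.
Proof.
move=> pI; elim: n => [|n [IHc IHs]] /=.
  split; first by rewrite inE pI.
  by have [s [/ladderN + _ <-]] := max_ladder_witness (consistent [::]).
case: pickP => // z _; rewrite /extend_mistakes; set M := mistakes p n in IHc IHs *.
have split := max_ladder_split M z.
case: ifP => [/andP[/andP[xz _]]|_]; last case: ifP => [/andP[/andP[zy _]]|_] //.
  rewrite /predict -ltnNge => lt.
  have pc : p \in consistent ((z, true) :: M) by move: IHc; rewrite !inE /= xz.
  by split=> //=; lia.
rewrite /predict => le.
have pc : p \in consistent ((z, false) :: M) by move: IHc; rewrite !inE /= zy.
split=> //=; apply: leq_trans IHs; rewrite addSnnS leq_add2l; apply: leq_trans split.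
by rewrite -add1n leq_add2r (leq_trans _ le) // (max_ladder_gt0 pI pc).
Qed.

(** * Signatures *)

Definition rk_sup : nat := (\max_z rk z).+1.

Lemma rk_lt_sup z : rk z < rk_sup.
Proof. by rewrite ltnS (leq_bigmax (F := rk)). Qed.

(** The rank of the vertex of color a near v; there is at most one, because two
    weakly 2r-reachable vertices of v are weakly 4r-reachable one from the other
    ([color_rankE]).  Out-of-range ranks stand for the absence of such a vertex. *)
Definition color_rank v (a : 'I_c) : nat :=
  if [pick u | (phi u == a) && walk (2 * r) (rk u) v u] is Some u then rk u else rk_sup.

Lemma color_rankE v u : walk (2 * r) (rk u) v u -> color_rank v (phi u) = rk u.
Proof.
move=> wu; rewrite /color_rank; case: pickP => [u' /andP[/eqP E wu']|/(_ u)]; last first.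
  by rewrite eqxx wu.
congr rk; apply/eqP; apply: contraT => ne; have [le|/ltnW le] := leqP (rk u) (rk u').
  have := walk_trans (walk_sym (walk_weaken (leqnn _) le wu')) wu.
  rewrite -mulnDl => /phi_sep; rewrite eq_sym => /(_ ne); by rewrite E eqxx.
have := walk_trans (walk_sym (walk_weaken (leqnn _) le wu)) wu'.
by rewrite -mulnDl => /phi_sep/(_ ne); rewrite E eqxx.
Qed.

(** Along a walk of rank at least k, the vertices of rank at most k that are
    weakly reachable are the same at both ends, up to the radius.  Going from m
    through v and w to the vertex u of the same color takes r + r + 2r steps,
    which is where the radius 4r comes from; so u and m cannot differ when one of
    them has rank at most k. *)
Lemma color_rank_transport k v w m : walk r k v w -> walk r (rk m) v m ->
  minn (rk m) k.+1 = minn (color_rank w (phi m)) k.+1.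
Proof.
move=> vw vm; have [le|lt] := leqP (rk m) k.
  rewrite color_rankE // mul2n -addnn.
  exact: walk_trans (walk_sym (walk_weaken (leqnn _) le vw)) vm.
rewrite /color_rank; case: pickP => [u /andP[/eqP E wu]|_]; last first.
  by have := rk_lt_sup m; lia.
have [ku|uk] := ltnP k (rk u); first by lia.
have um : u != m by apply: contraTneq lt => <-; rewrite -leqNgt.
have mv := walk_weaken (leqnn r) (ltnW (leq_ltn_trans uk lt)) (walk_sym vm).
have vw' := walk_weaken (leqnn r) uk vw.
have : walk (4 * r) (rk u) m u.
  by apply: walk_weaken (walk_trans (walk_trans mv vw') wu) => //; lia.
by move=> /phi_sep/(_ um); rewrite E eqxx.
Qed.

(** The comparison is with the vertex of the same color near the opposite end of
    the pair: the relations of an alternating cycle join one end of each pair to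
    the opposite end of the next, so this is the vertex that a mistake of the
    adjacent pair is carried to. *)
Definition code p (m : P * bool) : 'I_c * bool * bool :=
  (phi m.1, m.2, rk m.1 <= color_rank (if m.2 then p.2 else p.1) (phi m.1)).

Definition signature p : N.-tuple (option ('I_c * bool * bool)) :=
  [tuple onth (map (code p) (mistakes p rk_sup)) i | i < N].

Lemma signature_inj p q : p \in Inc P -> q \in Inc P -> signature p = signature q ->
  map (code p) (mistakes p rk_sup) = map (code q) (mistakes q rk_sup).
Proof.
move=> pI qI E.
have [_ sp] := mistakes_bounded rk_sup pI; have [_ sq] := mistakes_bounded rk_sup qI.
apply: (@eq_from_onth_bounded _ N); rewrite ?size_map; try lia.
by move=> i lt; have := congr1 (fun t => tnth t (Ordinal lt)) E; rewrite !tnth_mktuple.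
Qed.

(** An alternating cycle of pairs with equal signatures is presented as a
    periodic sequence f of period n + 1.  Let z be of least rank among the
    vertices realising its relations.  For the j-th mistake, the truncated rank t
    at one pair equals the truncated rank o of the opposite vertex of its color
    at an adjacent pair, by [color_rank_transport], and the order between t and o
    is part of the signature; so t is monotone along the cycle, hence constant.
    It follows that all the pairs have the same mistakes before z and at z, which
    is absurd as z is above one pair and below the next. *)
Lemma signature_no_cycle (f : nat -> P * P) n :
    (forall i, f i \in Inc P) -> (forall i, f (i + n.+1) = f i) ->
    (forall i, signature (f i) = signature (f 0)) ->
    (forall i, (f i).1 <= (f i.+1).2)%O -> False.
Proof.
move=> fI per sig fle.
have [w wP] : exists w : 'I_n.+1 -> P, forall i : 'I_n.+1,
     [/\ above (f i) (w i), below (f i.+1) (w i) & walk r (rk (w i)) (f i).1 (f i.+1).2].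
  apply: (@fin_all_exists _ _ (fun (i : 'I_n.+1) z => [/\ above (f i) z, below (f i.+1) z
     & walk r (rk z) (f i).1 (f i.+1).2])) => i.
  have [z [xz zy wx wy wxy]] := le_walk (fle i).
  by exists z; split=> //; apply/andP.
pose i0 := [arg min_(i < ord0) rk (w i)]; pose z := w i0.
have zmin i : rk z <= rk (w i) by rewrite /z /i0; case: arg_minnP => // i1 _; apply.
have fmod i : f (i %% n.+1) = f i.
  rewrite {2}(divn_eq i n.+1); elim: (i %/ n.+1) => [|q IH]; first by rewrite mul0n.
  by rewrite mulSn -addnA addnC per.
have fwalk i : walk r (rk z) (f i).1 (f i.+1).2.
  have [_ _] := wP (inord (i %% n.+1)).
  rewrite inordK ?ltn_mod // fmod => wi.
  have -> : f i.+1 = f (i %% n.+1).+1.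
    by rewrite -[LHS]fmod -[RHS]fmod -addn1 -[in RHS]addn1 modnDml.
  exact: walk_weaken (zmin _) wi.
pose ms i := mistakes (f i) rk_sup.
have codeE i j : map (code (f i)) (ms i) = map (code (f j)) (ms j).
  by apply: signature_inj; rewrite ?sig.
have szE i j : size (ms i) = size (ms j).
  by have := congr1 size (codeE i j); rewrite !size_map.
pose m i j := nth (z, true) (ms i) j.
have mcode i j : j < size (ms 0) -> code (f i) (m i j) = code (f 0) (m 0 j).
  move=> lt; have := congr1 (fun s => nth (code (f 0) (z, true)) s j) (codeE i 0).
  by rewrite /= !(nth_map (z, true)) // (szE i 0).
have msE i j : j < size (ms 0) ->
    if (m i j).2 then above (f i) (m i j).1 else below (f i) (m i j).1.
  by move=> lt; have [|] := @mistakesP (f i) rk_sup (m i j); first by rewrite mem_nth ?(szE i 0).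
pose t j i := minn (rk (m i j).1) (rk z).+1.
have t_const j i : j < size (ms 0) -> t j i = t j 0.
  move=> lt.
  have [col lab] : (forall i, phi (m i j).1 = phi (m 0 j).1) /\ forall i, (m i j).2 = (m 0 j).2.
    by split=> k; have := mcode k j lt; case.
  pose oc i := color_rank (if (m 0 j).2 then (f i).2 else (f i).1) (phi (m 0 j).1).
  pose o i := minn (oc i) (rk z).+1.
  have per_t k : t j (k + n.+1) = t j k by rewrite /t /m /ms per.
  have t_o : (forall k, t j k <= o k) \/ (forall k, o k <= t j k).
    have ord k : (rk (m k j).1 <= oc k) = (rk (m 0 j).1 <= oc 0).
      by have := mcode k j lt; rewrite /code col lab => -[].
    case: (boolP (rk (m 0 j).1 <= oc 0)) ord => _ ord; [left|right] => k.
      by have := ord k; rewrite /t /o; lia.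
    by have := ord k; rewrite /t /o; lia.
  have o_t : if (m 0 j).2 then (forall k, t j k = o k.+1) else (forall k, t j k.+1 = o k).
    rewrite /t /o /oc; case: ifP => l0 k.
      have := msE k j lt; rewrite lab l0 => /andP[_ wm].
      by rewrite (color_rank_transport (fwalk k) wm) col.
    have := msE k.+1 j lt; rewrite lab l0 => /andP[_ wm].
    by rewrite (color_rank_transport (walk_sym (fwalk k)) wm) col.
  apply: monotone_periodic_const per_t i.
  case: ifP o_t => _ o_t; case: t_o => t_o; [left|right|right|left] => k;
    by rewrite (o_t k).
(* truncating at rk z + 1 covers both the mistakes before z and the one at z *)
have prefix i k : k <= (rk z).+1 -> mistakes (f i) k = mistakes (f 0) k.
  move=> kz; have ks : k <= rk_sup by apply: leq_trans kz (rk_lt_sup z).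
  rewrite !(mistakes_filter _ ks).
  apply: (filter_truncated_eq (f := fun m => rk m.1) (x0 := (z, true))); first exact: szE.
    move=> j lt; rewrite (szE i 0) in lt; have := t_const j i lt.
    by rewrite /t -/(m i j) -/(m 0 j) /=; move: (rk (m i j).1) (rk (m 0 j).1) => a b; lia.
  move=> j lt /rk_inj; rewrite (szE i 0) in lt; have [_] := mcode i j lt.
  by rewrite /m; case: (nth _ _ _) => a b; case: (nth _ _ _) => a' b' /= -> _ ->.
have extendE i : mistakes (f i) (rk z).+1 = extend_mistakes (f i) (mistakes (f 0) (rk z)) z.
  rewrite /= -(prefix i) //; case: pickP => [u /eqP/rk_inj -> //|/(_ z)].
  by rewrite eqxx.
have [za zb _] := wP i0; have zna := above_below (fI _) za.
have znb : ~~ above (f i0.+1) z by apply: contraL zb; apply: above_below.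
have := prefix i0 _ (leqnn _); rewrite -(prefix i0.+1) // !extendE /extend_mistakes.
rewrite -/z in za zb; rewrite za zb (negPf zna) (negPf znb) /=.
by case: (predict _ _) => /= /(congr1 size) /=; lia.
Qed.

Lemma signature_reversible (s : N.-tuple (option ('I_c * bool * bool))) :
  reversible [set p in Inc P | signature p == s].
Proof.
apply: acyclic_reversible => p q /connectP[t pt ->]; apply/negP=> back.
pose I := [set p in Inc P | signature p == s].
pose f i := nth p (p :: t) (i %% (size t).+1).
have step i : alternating I (f i) (f i.+1).
  rewrite /f -[i.+1]addn1 -modnDml addn1.
  have := ltn_pmod i (ltn0Sn (size t)); set k := i %% _; rewrite ltnS leq_eqVlt.
  case/predU1P=> [->|lt]; first by rewrite modnn nth_last.
  by rewrite modn_small // (pathP p pt).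
have fI i : f i \in I by case/and3P: (step i).
apply: (@signature_no_cycle f (size t)) => i.
- by have := fI i; rewrite inE => /andP[].
- by rewrite /f modnDr.
- by have := fI i; have := fI 0; rewrite !inE => /andP[_ /eqP->] /andP[_ /eqP->].
- by case/and3P: (step i).
Qed.
End Prediction.

(** * The dimension bound *)

Theorem corollary6 :
  forall C : sgraph -> Prop, nowhere_dense C ->
  exists g : nat -> nat,
    forall h : nat, 1 <= h ->
    forall (d : Order.disp_t) (P : finPOrderType d) (P_gt0 : 0 < #|P|),
      height P <= h -> C (cover_graph P_gt0) ->
      let c := wcol (cover_graph P_gt0) (4 * h - 4) in
      poset_dim P <= (3 * c) ^ g h.
Proof.
move=> C ndC.
have [N ladN] : exists N : nat -> nat, forall h, 1 <= h ->
    forall (d : Order.disp_t) (P : finPOrderType d) (P_gt0 : 0 < #|P|),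
    height P <= h -> C (cover_graph P_gt0) ->
    forall s : seq (P * P), ladder s -> size s <= N h.
  apply: (functional_choice (fun h N => 1 <= h ->
    forall (d : Order.disp_t) (P : finPOrderType d) (P_gt0 : 0 < #|P|),
    height P <= h -> C (cover_graph P_gt0) ->
    forall s : seq (P * P), ladder s -> size s <= N)) => -[|h]; first by exists 0.
  have [t _ nosub] := ndC h.+1.*2 isT; exists (ladder_bound h.+1 t) => _ d P P_gt0 hP CP s lad.
  rewrite leqNgt; apply/negP=> /ltnW le; apply: (nosub _ CP).
  exact: ladder_subdivided_clique le.
exists (fun h => 2 * N h) => -[|r] // _ d P P_gt0 hP CP; set c := wcol _ _ => /=.
have [c_gt0 [rk [phi [rk_inj phi_sep]]]] := wcol_coloring (cover_graph P_gt0) (4 * r.+1 - 4).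
rewrite -/c in c_gt0 phi phi_sep.
have ladP := ladN r.+1 isT d P P_gt0 hP CP.
have r4 : 4 * r.+1 - 4 = 4 * r by rewrite mulnS addKn.
rewrite r4 in phi_sep.
have card_sig : #|{: (N r.+1).-tuple (option ('I_c * bool * bool))}| = (c * 2 * 2).+1 ^ N r.+1.
  by rewrite card_tuple card_option !card_prod card_ord card_bool.
apply: leq_trans (poset_dim_leq (S := (N r.+1).-tuple (option ('I_c * bool * bool))) _
  (signature_reversible ladP hP rk_inj phi_sep)) _.
  by rewrite card_sig expn_gt0.
rewrite card_sig expnM; have [->|N0] := posnP (N r.+1); rewrite ?expn0 // leq_exp2r //.
(* 4c + 1 is at most the square of 3c *)
nia.
Qed.
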